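(* (i) Let $a,b,x,y$ be real with $|a|<|b|$ and put $\rho=a/b$. Then $$\sum_{n\ge0}\frac{\rho^n}{n!}H_n(x-a)H_n(y-b)=\frac{1}{\sqrt{1-\rho^2}}\exp\left(-\frac{(x-\rho y)^2}{2(1-\rho^2)}+\frac{(x-a)^2}{2}\right).$$ (ii) Let $a,b$ be real with $1>|b|>|a|$, let $x,y\in[-2,2]$ and put $\rho=a/b$. Then $$\sum_{n\ge0}\rho^n\left(U_n(x/2)-aU_{n-1}(x/2)\right)\left(U_n(y/2)-bU_{n-1}(y/2)\right)=(1-\rho^2)\frac{1-ax+a^2}{w(x,y,\rho|0)}.$$ (iii) Let $x,y,z$ be real and let $\rho_1,\rho_2$ be real with $|\rho_1|,|\rho_2|<1$. Then $$\sum_{n=0}^\infty\frac{\rho_1^n(1-\rho_2^2)^{n/2}}{n!\,(1-\rho_1^2\rho_2^2)^{n/2}}H_n\!\left(\frac{x-\rho_1\rho_2y}{\sqrt{1-\rho_1^2\rho_2^2}}\right)H_n\!\left(\frac{z-\rho_2y}{\sqrt{1-\rho_2^2}}\right)=\sqrt{\frac{1-\rho_1^2\rho_2^2}{1-\rho_1^2}}\exp\left(-\frac{(x-\rho_1z)^2}{2(1-\rho_1^2)}+\frac{(x-\rho_1\rho_2y)^2}{2(1-\rho_1^2\rho_2^2)}\right).$$ (iv) Let $x,y,z\in[-2,2]$ and let $\rho_1,\rho_2$ be real with $|\rho_1|,|\rho_2|<1$. Then $$1+\frac{1}{1-\rho_1^2\rho_2^2}\sum_{n\ge1}\rho_1^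nP_n(x|y,\rho_1\rho_2,0)P_n(z|y,\rho_2,0)=\frac{(1-\rho_1^2)\,w(x,y,\rho_1\rho_2|0)}{(1-\rho_1^2\rho_2^2)\,w(x,z,\rho_1|0)}.$$
   Context: Convention: $0^0=1$. $H_n$ are the probabilists' Hermite polynomials: $H_{-1}=0$, $H_0=1$, $H_{n+1}(x)=xH_n(x)-nH_{n-1}(x)$. $U_n$ are the Chebyshev polynomials of the second kind: $U_{-1}=0$, $U_0=1$, $U_{n+1}(x)=2xU_n(x)-U_{n-1}(x)$. $P_n(x|y,\rho,0)$ is the $q=0$ case of the Al-Salam--Chihara polynomials: $P_0=1$, $P_1(x|y,\rho,0)=x-\rho y$, $P_2(x|y,\rho,0)=xP_1(x|y,\rho,0)-(1-\rho^2)$, and $P_{n+1}(x|y,\rho,0)=xP_n(x|y,\rho,0)-P_{n-1}(x|y,\rho,0)$ for $n\ge2$. Equivalently, $P_n(x|y,\rho,0)=U_n(x/2)-\rho yU_{n-1}(x/2)+\rho^2U_{n-2}(x/2)$ for $n\ge1$. $w(x,y,\rho|0)=(1-\rho^2)^2-\rho(1+\rho^2)xy+\rho^2(x^2+y^2)$. *)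

(* Defs.v *)
From Stdlib Require Import Reals Lra Lia.
From Coquelicot Require Import Coquelicot.
Open Scope R_scope.

(** Polynomials are represented by their evaluation functions.  In the
    recursions below the inner [match] on the predecessor encodes the
    convention that the polynomial of index -1 is zero. *)

(** Probabilists' Hermite polynomials. *)
Fixpoint hermite (n : nat) (x : R) : R :=
  match n with
  | O => 1
  | S m => x * hermite m x
           - INR m * match m with O => 0 | S k => hermite k x end
  end.

(** Chebyshev polynomials of the second kind. *)
Fixpoint chebyU (n : nat) (x : R) : R :=
  match n with
  | O => 1
  | S m => 2 * x * chebyU m x
           - match m with O => 0 | S k => chebyU k x end
  end.

(** [chebyU_prev n] is U_{n-1}, including the case U_{-1} = 0. *)
Definition chebyU_prev (n : nat) (x : R) : R :=
  match n with O => 0 | S m => chebyU m x end.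

(** Al-Salam--Chihara polynomials P_n(x|y,rho,q) at q = 0.  The recursion
    coefficient 1 - rho^2 occurs only in the step producing P_2. *)
Fixpoint ascP (n : nat) (x y rho : R) : R :=
  match n with
  | O => 1
  | S m => match m with
           | O => x - rho * y
           | S k => x * ascP m x y rho
                    - match k with
                      | O => 1 - rho ^ 2
                      | S _ => ascP k x y rho
                      end
           end
  end.

(** w(x,y,rho|q) at q = 0. *)
Definition w0 (x y rho : R) : R :=
  (1 - rho ^ 2) ^ 2 - rho * (1 + rho ^ 2) * x * y + rho ^ 2 * (x ^ 2 + y ^ 2).

Lemma chebyU_succ (n : nat) (x : R) :
  chebyU (S n) x = 2 * x * chebyU n x - chebyU_prev n x.
Proof. reflexivity. Qed.

Lemma ascP_chebyU (n : nat) (x y rho : R) :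
  ascP (S n) x y rho =
    chebyU (S n) (x / 2) - rho * y * chebyU n (x / 2)
    + rho ^ 2 * chebyU_prev n (x / 2).
Proof.
enough (H : forall m, (m <= n)%nat -> ascP (S m) x y rho =
    chebyU (S m) (x / 2) - rho * y * chebyU m (x / 2)
    + rho ^ 2 * chebyU_prev m (x / 2)) by (apply H; lia).
induction n as [|n IH]; intros m Hm.
- replace m with O by lia; simpl; field.
- destruct (Nat.eq_dec m (S n)) as [->|Hne]; [|apply IH; lia].
  destruct n as [|n]; [simpl; field|].
  change (ascP (S (S (S n))) x y rho)
    with (x * ascP (S (S n)) x y rho - ascP (S n) x y rho).
  rewrite (IH (S n)), (IH n) by lia.
  rewrite !chebyU_succ; cbn [chebyU_prev]; rewrite ?chebyU_succ.
  destruct n as [|n]; cbn [chebyU_prev]; [simpl; field|].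
  rewrite !chebyU_succ; field.
Qed.

(* Main.v *)
Require Import Defs.
From Stdlib Require Import Reals Factorial Lra Lia.
From Coquelicot Require Import Coquelicot.
Open Scope R_scope.

(** Parts (i) and (iii) are Mehler's formula after a change of variables.  The
    coefficients [H_n(x) H_n(y) / n!] satisfy a recurrence which says that their
    generating function in t solves the same first-order linear equation as the
    closed form.  Parts (ii) and (iv) concern products of two sequences obeying
    the Chebyshev recurrence; their generating function is rational with
    denominator [w], and its numerator is read off the initial values.  In (iv)
    this applies to [P_(n+1)], since the recurrence of [P_n] starts at n = 1. *)

(** * Sequences of subexponential growth and their power series *)

(** Amounts to radius of convergence at least 1. Asking for every rate [q > 1], rather than one
    fixed bound, makes the class stable under products. *)
Definition subexp (a : nat -> R) : Prop :=
  forall q, 1 < q -> exists C, forall n, Rabs (a n) <= C * q ^ n.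

Lemma subexp_le (a b : nat -> R) :
  (forall n, Rabs (a n) <= Rabs (b n)) -> subexp b -> subexp a.
Proof.
intros Hab Hb q Hq; destruct (Hb q Hq) as [C HC].
exists C; intro n; eapply Rle_trans; [apply Hab | apply HC].
Qed.

Lemma subexp_succ (a : nat -> R) : subexp a -> subexp (fun n => a (S n)).
Proof.
intros Ha q Hq; destruct (Ha q Hq) as [C HC].
exists (C * q); intro n; specialize (HC (S n)); simpl in HC.
rewrite Rmult_assoc; exact HC.
Qed.

Lemma subexp_plus (a b : nat -> R) :
  subexp a -> subexp b -> subexp (fun n => a n + b n).
Proof.
intros Ha Hb q Hq; destruct (Ha q Hq) as [C HC]; destruct (Hb q Hq) as [D HD].
exists (C + D); intro n.
generalize (Rabs_triang (a n) (b n)) (HC n) (HD n); lra.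
Qed.

Lemma subexp_mult (a b : nat -> R) :
  subexp a -> subexp b -> subexp (fun n => a n * b n).
Proof.
intros Ha Hb q Hq.
(* The rate [q] is shared equally between the two factors. *)
assert (Hs : 1 < sqrt q) by (rewrite <- sqrt_1; apply sqrt_lt_1_alt; lra).
destruct (Ha _ Hs) as [C HC]; destruct (Hb _ Hs) as [D HD].
exists (C * D); intro n; rewrite Rabs_mult.
replace (C * D * q ^ n) with ((C * sqrt q ^ n) * (D * sqrt q ^ n)).
- apply Rmult_le_compat; auto using Rabs_pos.
- rewrite <- (sqrt_sqrt q) at 3 by lra; rewrite Rpow_mult_distr; ring.
Qed.

Lemma subexp_affine (A B : R) : subexp (fun n => A + B * INR n).
Proof.
intros q Hq; exists (Rabs A + Rabs B / (q - 1)); intro n.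
(* Bernoulli's inequality; it bounds both [1] and [INR n] by multiples of [q ^ n]. *)
assert (Hn : 1 + INR n * (q - 1) <= q ^ n).
{ replace (q ^ n) with ((1 + (q - 1)) ^ n) by (f_equal; ring).
  apply poly; lra. }
pose proof (pos_INR n) as Hp.
assert (H1 : 1 <= q ^ n) by (generalize (Rmult_le_pos _ (q - 1) Hp); lra).
assert (H2 : INR n <= q ^ n / (q - 1)) by (apply Rle_div_r; lra).
eapply Rle_trans; [apply Rabs_triang|].
rewrite Rabs_mult, (Rabs_pos_eq (INR n)) by exact Hp.
generalize (Rmult_le_compat_l _ _ _ (Rabs_pos A) H1)
  (Rmult_le_compat_l _ _ _ (Rabs_pos B) H2).
unfold Rdiv; lra.
Qed.

Lemma geometric_bound_of_ratio (q : R) (N : nat) (u : nat -> R) :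
  0 < q -> (forall n, (N <= n)%nat -> u (S n) <= q * u n) ->
  exists C, forall n, u n <= C * q ^ n.
Proof.
intro Hq; revert u; induction N as [|N IH]; intros u Hu.
- exists (u O); induction n as [|n IHn]; [simpl; lra|].
  eapply Rle_trans; [apply Hu; lia|].
  replace (u O * q ^ S n) with (q * (u O * q ^ n)) by (simpl; ring).
  apply Rmult_le_compat_l; lra.
- destruct (IH (fun n => u (S n))) as [C HC]; [intros; apply Hu; lia|].
  (* The maximum covers the dropped first term, and [C / q] undoes the index shift. *)
  exists (Rmax (u O) (C / q)); intros [|n].
  + simpl; rewrite Rmult_1_r; apply Rmax_l.
  + eapply Rle_trans; [apply HC|].
    replace (C * q ^ n) with (C / q * q ^ S n) by (simpl; field; lra).
    apply Rmult_le_compat_r; [apply pow_le; lra | apply Rmax_r].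
Qed.

(** For [r] strictly between [Rabs t] and 1, growth at rate [/ r] keeps [a n * r ^ n] bounded. *)
Lemma subexp_CV_radius (a : nat -> R) (t : R) :
  subexp a -> Rabs t < 1 -> Rbar_lt (Rabs t) (CV_radius a).
Proof.
intros Ha Ht; pose proof (Rabs_pos t) as Hp.
set (r := (1 + Rabs t) / 2).
assert (Hr : Rabs t < r < 1) by (unfold r; lra).
apply Rbar_lt_le_trans with r; [simpl; lra|].
apply (proj1 (CV_radius_bounded a)).
destruct (Ha (/ r)) as [C HC].
{ rewrite <- Rinv_1; apply Rinv_lt_contravar; lra. }
exists C; intro n; rewrite Rabs_mult, <- RPow_abs, (Rabs_pos_eq r) by lra.
replace C with (C * (/ r) ^ n * r ^ n).
- apply Rmult_le_compat_r; [apply pow_le; lra | apply HC].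
- rewrite pow_inv; field; apply pow_nonzero; lra.
Qed.

Lemma is_series_subexp (a : nat -> R) (t : R) :
  subexp a -> Rabs t < 1 -> is_series (fun n => a n * t ^ n) (PSeries a t).
Proof.
intros Ha Ht; apply Series_correct, ex_series_Rabs, CV_disk_inside.
now apply subexp_CV_radius.
Qed.

Lemma PSeries_subexp_succ (a : nat -> R) (t : R) :
  subexp a -> Rabs t < 1 ->
  PSeries a t = a O + t * PSeries (fun n => a (S n)) t.
Proof.
intros Ha Ht; apply PSeries_decr_1, ex_pseries_R.
exists (PSeries a t); now apply is_series_subexp.
Qed.

(** Nested uses turn a linear recurrence of the coefficients into a linear relation between the sums
    of the shifted series. *)
Lemma is_series_lin (c t : R) (a b : nat -> R) (A B : R) :
  is_series (fun n => a n * t ^ n) A -> is_series (fun n => b n * t ^ n) B ->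
  is_series (fun n => (c * a n + b n) * t ^ n) (c * A + B).
Proof.
intros Ha Hb.
eapply is_series_ext;
  [|exact (is_series_plus _ _ _ _ (is_series_scal_l c _ _ Ha) Hb)].
intro n; unfold plus, scal; simpl; unfold mult; simpl; ring.
Qed.

Lemma is_series_zero_coef (t l : R) (a : nat -> R) :
  (forall n, a n = 0) -> is_series (fun n => a n * t ^ n) l -> l = 0.
Proof.
intros Ha Hl; rewrite <- (is_series_unique _ _ Hl).
rewrite (Series_ext _ (fun n => 0 * t ^ n)) by (intro n; now rewrite Ha).
rewrite Series_scal_l; ring.
Qed.

(** * Chebyshev-type products and their rational generating functions *)

(** For [x = 2 cos u], [y = 2 cos v], [w0] is the product of [1 - 2 rho cos(u + v) + rho^2] and
    [1 - 2 rho cos(u - v) + rho^2]. The proof avoids angles: [w0] is [L^2] minus a term that is at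
    most [(r * (4 - p) / 2)^2], and [L] exceeds that root. *)
Lemma w0_pos (x y rho : R) :
  -2 <= x <= 2 -> -2 <= y <= 2 -> Rabs rho < 1 -> 0 < w0 x y rho.
Proof.
intros Hx Hy Hr.
set (r := Rabs rho); set (p := Rabs (x * y)).
set (L := 1 + rho ^ 2 - rho * (x * y) / 2).
assert (Hr0 : 0 <= r) by apply Rabs_pos.
assert (Hp0 : 0 <= p) by apply Rabs_pos.
assert (Hr2 : rho ^ 2 = r ^ 2) by (unfold r; now rewrite pow2_abs).
assert (Hp2 : (x * y) ^ 2 = p ^ 2) by (unfold p; now rewrite pow2_abs).
assert (Hp : p <= 4).
{ unfold p; rewrite Rabs_mult.
  assert (Rabs x <= 2) by (apply Rabs_le; lra).
  assert (Rabs y <= 2) by (apply Rabs_le; lra).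
  generalize (Rabs_pos x) (Rabs_pos y); nra. }
assert (Hrp : rho * (x * y) <= r * p).
{ unfold r, p; rewrite <- Rabs_mult; apply Rle_abs. }
assert (Hxy : 2 * p <= x ^ 2 + y ^ 2).
{ unfold p, Rabs; destruct (Rcase_abs (x * y));
  generalize (pow2_ge_0 (x - y)) (pow2_ge_0 (x + y)); lra. }
(* From [1 + r^2 > 2 r] and [rho * (x * y) <= r * p]. *)
assert (HL : r * (4 - p) / 2 < L).
{ unfold L; rewrite Hr2.
  assert (0 < (1 - r) ^ 2) by (apply pow_lt; unfold r; lra). nra. }
replace (w0 x y rho)
  with (L ^ 2 - r ^ 2 * ((4 - x ^ 2) * (4 - y ^ 2)) / 4)
  by (rewrite <- Hr2; unfold w0, L; field).
assert (Hs : (4 - x ^ 2) * (4 - y ^ 2) <= (4 - p) ^ 2).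
{ replace ((4 - x ^ 2) * (4 - y ^ 2))
    with (16 - 4 * (x ^ 2 + y ^ 2) + (x * y) ^ 2) by ring.
  rewrite Hp2; nra. }
assert (H0 : 0 <= r * (4 - p) / 2) by nra.
assert (H1 : (r * (4 - p) / 2) ^ 2 < L ^ 2) by nra.
assert (H2 : r ^ 2 * ((4 - x ^ 2) * (4 - y ^ 2)) <= r ^ 2 * (4 - p) ^ 2)
  by (apply Rmult_le_compat_l; [apply pow2_ge_0 | exact Hs]).
replace ((r * (4 - p) / 2) ^ 2) with (r ^ 2 * (4 - p) ^ 2 / 4) in H1 by field.
lra.
Qed.

(* The quadratic form [f_(n+1)^2 - x f_n f_(n+1) + f_n^2] is conserved and
   nonnegative for |x| <= 2, so |f_(n+1)| exceeds |f_n| by at most a constant. *)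
Lemma subexp_chebyshev_recurrence (x : R) (f : nat -> R) :
  -2 <= x <= 2 -> (forall n, f (S (S n)) = x * f (S n) - f n) -> subexp f.
Proof.
intros Hx Hf.
set (Q := fun n => f (S n) ^ 2 - x * f n * f (S n) + f n ^ 2).
assert (HQ : forall n, Q n = Q O).
{ induction n as [|n IH]; [reflexivity|].
  rewrite <- IH; unfold Q; rewrite Hf; ring. }
assert (Hstep : forall n, Rabs (f (S n)) <= Rabs (f n) + sqrt (Q O)).
{ intro n; rewrite <- (HQ n).
  (* Completing the square: [Q n = (f (S n) - x / 2 * f n)^2 + (1 - x^2 / 4) * f n ^ 2], so the
     second summand is at most [sqrt (Q n)]. *)
  replace (f (S n)) with (x / 2 * f n + (f (S n) - x / 2 * f n)) at 1 by ring.
  eapply Rle_trans; [apply Rabs_triang|]; apply Rplus_le_compat.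
  - rewrite Rabs_mult.
    assert (Rabs (x / 2) <= 1) by (apply Rabs_le; lra).
    generalize (Rabs_pos (f n)); nra.
  - rewrite <- sqrt_Rsqr_abs; apply sqrt_le_1_alt; unfold Rsqr, Q.
    assert (0 <= (1 - x ^ 2 / 4) * f n ^ 2)
      by (apply Rmult_le_pos; [nra | apply pow2_ge_0]).
    lra. }
apply subexp_le with (fun n => Rabs (f O) + sqrt (Q O) * INR n);
  [|apply subexp_affine].
assert (Hb : forall n, Rabs (f n) <= Rabs (f O) + sqrt (Q O) * INR n).
{ induction n as [|n IH]; [simpl; lra|].
  rewrite S_INR; generalize (Hstep n); lra. }
intro n; eapply Rle_trans; [apply Hb | apply Rle_abs].
Qed.

(* The products [f n * g n] obey a palindromic fourth-order recurrence whose
   characteristic polynomial is [w0 x y]. *)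
Lemma is_series_chebyshev_product (x y t : R) (f g : nat -> R) :
  -2 <= x <= 2 -> -2 <= y <= 2 -> Rabs t < 1 ->
  (forall n, f (S (S n)) = x * f (S n) - f n) ->
  (forall n, g (S (S n)) = y * g (S n) - g n) ->
  is_series (fun n => t ^ n * f n * g n)
    ((f 0%nat * g 0%nat + t * (f 1%nat * g 1%nat - x * y * f 0%nat * g 0%nat)
      + t ^ 2 * ((x ^ 2 + y ^ 2 - 1) * f 0%nat * g 0%nat
                 - x * f 1%nat * g 0%nat - y * f 0%nat * g 1%nat)
      - t ^ 3 * (x * f 0%nat - f 1%nat) * (y * g 0%nat - g 1%nat))
     / w0 x y t).
Proof.
intros Hx Hy Ht Hf Hg.
set (h := fun n => f n * g n).
assert (H0 : subexp h).
{ apply subexp_mult;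
    [apply (subexp_chebyshev_recurrence x) | apply (subexp_chebyshev_recurrence y)];
    assumption. }
pose proof (subexp_succ _ H0) as H1; pose proof (subexp_succ _ H1) as H2.
pose proof (subexp_succ _ H2) as H3; pose proof (subexp_succ _ H3) as H4.
assert (Hrec : PSeries (fun n => h (S (S (S (S n))))) t
  = x * y * PSeries (fun n => h (S (S (S n)))) t
    - (x ^ 2 + y ^ 2 - 2) * PSeries (fun n => h (S (S n))) t
    + x * y * PSeries (fun n => h (S n)) t - PSeries h t).
{ pose proof (is_series_lin (- (x * y)) t _ _ _ _ (is_series_subexp _ t H3 Ht)
    (is_series_lin (x ^ 2 + y ^ 2 - 2) t _ _ _ _ (is_series_subexp _ t H2 Ht)
    (is_series_lin (- (x * y)) t _ _ _ _ (is_series_subexp _ t H1 Ht)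
    (is_series_lin 1 t _ _ _ _ (is_series_subexp _ t H4 Ht)
      (is_series_subexp _ t H0 Ht))))) as HS.
  apply is_series_zero_coef in HS; [lra|].
  intro n; unfold h; rewrite !Hf, !Hg; ring. }
pose proof (PSeries_subexp_succ _ t H0 Ht) as E0.
pose proof (PSeries_subexp_succ _ t H1 Ht) as E1.
pose proof (PSeries_subexp_succ _ t H2 Ht) as E2.
pose proof (PSeries_subexp_succ _ t H3 Ht) as E3.
pose proof (w0_pos x y t Hx Hy Ht) as Hw.
eapply is_series_ext;
  [|match goal with |- is_series _ ?l =>
      replace l with (PSeries h t); [exact (is_series_subexp _ t H0 Ht)|] end].
{ intro n; unfold h; simpl; ring. }
apply (Rmult_eq_reg_r (w0 x y t)); [|lra].
unfold Rdiv; rewrite Rmult_assoc, Rinv_l, Rmult_1_r by lra.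
cbv beta in *; rewrite Hrec in E3; clear Hrec.
set (s0 := PSeries h t) in *.
set (s1 := PSeries (fun n => h (S n)) t) in *.
set (s2 := PSeries (fun n => h (S (S n))) t) in *.
set (s3 := PSeries (fun n => h (S (S (S n)))) t) in *.
(* Each shifted sum is expressed through [s0] after multiplication by a power of [t]; nothing is
   divided by [t], so [t = 0] needs no separate case. *)
assert (T1 : t * s1 = s0 - h 0%nat) by lra.
assert (T2 : t ^ 2 * s2 = s0 - h 0%nat - t * h 1%nat).
{ replace (t ^ 2 * s2) with (t * (t * s2)) by ring.
  replace (t * s2) with (s1 - h 1%nat) by lra; lra. }
assert (T3 : t ^ 3 * s3 = s0 - h 0%nat - t * h 1%nat - t ^ 2 * h 2%nat).
{ replace (t ^ 3 * s3) with (t ^ 2 * (t * s3)) by ring.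
  replace (t * s3) with (s2 - h 2%nat) by lra; lra. }
assert (K : t ^ 3 * s3 = t ^ 3 * h 3%nat + x * y * t * (t ^ 3 * s3)
  - (x ^ 2 + y ^ 2 - 2) * t ^ 2 * (t ^ 2 * s2)
  + x * y * t ^ 3 * (t * s1) - t ^ 4 * s0) by (apply (f_equal (Rmult (t ^ 3))) in E3; lra).
rewrite T1, T2, T3 in K.
assert (h2 : h 2%nat = (x * f 1%nat - f 0%nat) * (y * g 1%nat - g 0%nat))
  by (unfold h; now rewrite Hf, Hg).
assert (h3 : h 3%nat = (x * (x * f 1%nat - f 0%nat) - f 1%nat)
                       * (y * (y * g 1%nat - g 0%nat) - g 1%nat))
  by (unfold h; now rewrite !Hf, !Hg).
rewrite h2, h3 in K; unfold h in K; unfold w0; lra.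
Qed.

(** The convention for index -1 makes this valid from [n = 0] on. *)
Lemma chebyU_recurrence (c x : R) (n : nat) :
  chebyU (S (S n)) (x / 2) - c * chebyU_prev (S (S n)) (x / 2)
  = x * (chebyU (S n) (x / 2) - c * chebyU_prev (S n) (x / 2))
    - (chebyU n (x / 2) - c * chebyU_prev n (x / 2)).
Proof.
cbn [chebyU_prev]; rewrite !chebyU_succ; cbn [chebyU_prev].
rewrite ?chebyU_succ; field.
Qed.

Lemma Rabs_div_lt_1 (a b : R) : Rabs a < Rabs b -> Rabs (a / b) < 1.
Proof.
intro H; pose proof (Rabs_pos a).
unfold Rdiv; rewrite Rabs_mult, Rabs_inv; apply Rlt_div_l; lra.
Qed.

Lemma chebyshev_bilinear (a b x y : R) :
  Rabs a < Rabs b -> -2 <= x <= 2 -> -2 <= y <= 2 ->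
  is_series
    (fun n => (a / b) ^ n
      * (chebyU n (x / 2) - a * chebyU_prev n (x / 2))
      * (chebyU n (y / 2) - b * chebyU_prev n (y / 2)))
    ((1 - (a / b) ^ 2) * ((1 - a * x + a ^ 2) / w0 x y (a / b))).
Proof.
intros Hab Hx Hy.
pose proof (Rabs_div_lt_1 _ _ Hab) as Hr.
pose proof (w0_pos x y (a / b) Hx Hy Hr) as Hw.
pose proof (is_series_chebyshev_product x y (a / b)
  (fun n => chebyU n (x / 2) - a * chebyU_prev n (x / 2))
  (fun n => chebyU n (y / 2) - b * chebyU_prev n (y / 2))
  Hx Hy Hr (chebyU_recurrence a x) (chebyU_recurrence b y)) as HS.
assert (Hb : b <> 0) by (intros ->; rewrite Rabs_R0 in Hab; generalize (Rabs_pos a); lra).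
assert (Ha : a = a / b * b) by (field; exact Hb).
match type of HS with is_series _ (?N / _) =>
  replace ((1 - (a / b) ^ 2) * ((1 - a * x + a ^ 2) / w0 x y (a / b)))
    with (N / w0 x y (a / b)); [exact HS|] end.
(* Substituting [a = r * b] cancels the terms in [y], and the numerator factors as
   [(1 - r^2) * (1 - a * x + a^2)]. *)
generalize dependent (a / b); intros r _ Hw _ ->.
simpl; field; lra.
Qed.

(** Here [y] enters only through the initial values, so the denominator is [w0 x z r1]. The
    subtracted constant disappears on dividing by [1 - r1^2 * r2^2] and adding 1. *)
Lemma ascP_bilinear (x y z r1 r2 : R) :
  -2 <= x <= 2 -> -2 <= y <= 2 -> -2 <= z <= 2 -> Rabs r1 < 1 -> Rabs r2 < 1 ->
  is_series
    (fun n => r1 ^ S n * ascP (S n) x y (r1 * r2) * ascP (S n) z y r2)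
    ((1 - r1 ^ 2) * w0 x y (r1 * r2) / w0 x z r1 - (1 - r1 ^ 2 * r2 ^ 2)).
Proof.
intros Hx Hy Hz H1 H2.
pose proof (w0_pos x z r1 Hx Hz H1) as Hw.
pose proof (is_series_chebyshev_product x z r1
  (fun n => ascP (S n) x y (r1 * r2)) (fun n => ascP (S n) z y r2)
  Hx Hz H1 (fun _ => eq_refl) (fun _ => eq_refl)) as HS.
(* The extra factor [r1] accounts for the sequences starting at index 1. *)
apply (is_series_scal_l r1) in HS.
eapply is_series_ext;
  [|match type of HS with is_series _ ?l => match goal with |- is_series _ ?m =>
      replace m with l; [exact HS|] end end].
{ intro n; unfold scal; cbn -[ascP]; unfold mult; cbn -[ascP]; ring. }
unfold scal; simpl; unfold mult; simpl; unfold w0 in *; field; lra.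
Qed.

(** * Hermite products and Mehler's formula *)

Lemma hermite_succ_succ (n : nat) (x : R) :
  hermite (S (S n)) x = x * hermite (S n) x - INR (S n) * hermite n x.
Proof. reflexivity. Qed.

(* [h_(n+1)^2 + h_n^2] for [h_n = H_n / sqrt n!] grows by a factor tending to 1;
   squares avoid [sqrt n!]. *)
Lemma subexp_hermite_sqr (x : R) :
  subexp (fun n => hermite n x ^ 2 / INR (fact n)).
Proof.
intros q Hq; set (d := q - 1); assert (Hd : 0 < d) by (unfold d; lra).
set (v := fun n => hermite n x ^ 2 / INR (fact n)).
assert (Hv : forall n, 0 <= v n).
{ intro n; apply Rdiv_le_0_compat; [apply pow2_ge_0 | apply INR_fact_lt_0]. }
(* Beyond [N] the coefficient [(1 + / d) * x^2 / (n + 2)] of [v (S n)] is at most [d]; since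
   [1 + d = q], adding [v (S n)] then gives the ratio [q]. *)
destruct (INR_unbounded ((1 + / d) * x ^ 2 / d)) as [N HN].
destruct (geometric_bound_of_ratio q N (fun n => v (S n) + v n)) as [C HC];
  [lra | |].
- intros n Hn.
  assert (Hs : hermite (S (S n)) x ^ 2
    <= (1 + / d) * x ^ 2 * hermite (S n) x ^ 2
       + q * INR (S n) ^ 2 * hermite n x ^ 2).
  { rewrite hermite_succ_succ.
    set (A := x * hermite (S n) x); set (B := INR (S n) * hermite n x).
    (* Young's inequality [(A - B)^2 <= (1 + / d) * A^2 + (1 + d) * B^2]. *)
    assert (0 <= (A + d * B) ^ 2 / d) by (apply Rdiv_le_0_compat; [apply pow2_ge_0 | lra]).
    replace ((A + d * B) ^ 2 / d) with (/ d * A ^ 2 + 2 * A * B + d * B ^ 2) in H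
      by (field; lra).
    replace ((1 + / d) * x ^ 2 * hermite (S n) x ^ 2) with ((1 + / d) * A ^ 2)
      by (unfold A; ring).
    replace (q * INR (S n) ^ 2 * hermite n x ^ 2) with ((1 + d) * B ^ 2)
      by (unfold B, d; ring).
    lra. }
  pose proof (INR_fact_lt_0 n) as Hf; pose proof (pos_INR n) as Hn0.
  assert (Hnd : (1 + / d) * x ^ 2 <= d * (INR n + 2)).
  { apply le_INR in Hn.
    apply Rlt_div_l in HN; nra. }
  assert (H2 : v (S (S n)) <= d * v (S n) + q * v n).
  { apply Rle_trans with
      (((1 + / d) * x ^ 2 / (INR n + 2)) * v (S n)
       + q * ((INR n + 1) / (INR n + 2)) * v n).
    - unfold v; rewrite !fact_simpl, !mult_INR, !S_INR in *.
      replace ((1 + / d) * x ^ 2 / (INR n + 2)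
        * (hermite (S n) x ^ 2 / ((INR n + 1) * INR (fact n)))
        + q * ((INR n + 1) / (INR n + 2)) * (hermite n x ^ 2 / INR (fact n)))
        with (((1 + / d) * x ^ 2 * hermite (S n) x ^ 2
               + q * (INR n + 1) ^ 2 * hermite n x ^ 2)
              / ((INR n + 1 + 1) * ((INR n + 1) * INR (fact n))))
        by (field; lra).
      apply Rmult_le_compat_r; [|exact Hs].
      apply Rlt_le, Rinv_0_lt_compat; repeat apply Rmult_lt_0_compat; lra.
    - apply Rplus_le_compat; apply Rmult_le_compat_r; auto.
      + apply Rle_div_l; lra.
      + assert ((INR n + 1) / (INR n + 2) <= 1) by (apply Rle_div_l; lra). nra. }
  unfold d in H2; lra.
- exists C; intro n; rewrite Rabs_pos_eq by apply Hv.
  generalize (HC n) (Hv (S n)); unfold v; lra.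
Qed.

(** The inequality between a product and the sum of squares reduces the mixed case to the diagonal
    one. *)
Lemma subexp_hermite_product (x y : R) :
  subexp (fun n => hermite n x * hermite n y / INR (fact n)).
Proof.
eapply subexp_le;
  [|exact (subexp_plus _ _ (subexp_hermite_sqr x) (subexp_hermite_sqr y))].
intro n; eapply Rle_trans; [|apply Rle_abs].
unfold Rdiv; rewrite <- Rmult_plus_distr_r, Rabs_mult.
pose proof (Rinv_0_lt_compat _ (INR_fact_lt_0 n)) as Hf.
rewrite (Rabs_pos_eq (/ _)) by lra.
apply Rmult_le_compat_r; [lra|].
generalize (pow2_ge_0 (hermite n x - hermite n y))
  (pow2_ge_0 (hermite n x + hermite n y))
  (pow2_ge_0 (hermite n x)) (pow2_ge_0 (hermite n y)).
unfold Rabs; destruct (Rcase_abs _); lra.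
Qed.

(** This is the coefficient of [t^(n+3)] in [(1 - t^2)^2 F' = (t (1 - t^2) + x y (1 + t^2) - t (x^2
    + y^2)) F], where [F] is the generating function of [h]. *)
Lemma hermite_product_recurrence (x y : R) (n : nat) :
  let h := fun n => hermite n x * hermite n y / INR (fact n) in
  INR (4 + n) * h (4 + n)%nat
  = x * y * h (3 + n)%nat + 2 * (INR (2 + n) * h (2 + n)%nat)
    + (1 - x ^ 2 - y ^ 2) * h (2 + n)%nat + x * y * h (1 + n)%nat
    - INR n * h n - h n.
Proof.
cbv zeta; cbn [Nat.add]; rewrite !hermite_succ_succ, !fact_simpl, !mult_INR, !S_INR.
field; generalize (pos_INR n) (INR_fact_lt_0 n); intros; repeat split; lra.
Qed.

Definition mehler_gf (x y t : R) : R :=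
  PSeries (fun n => hermite n x * hermite n y / INR (fact n)) t.

(** The factor is the logarithmic derivative of Mehler's closed form. *)
Lemma is_derive_mehler_gf (x y t : R) :
  Rabs t < 1 ->
  is_derive (mehler_gf x y) t
    ((t * (1 - t ^ 2) + x * y * (1 + t ^ 2) - t * (x ^ 2 + y ^ 2))
     / (1 - t ^ 2) ^ 2 * mehler_gf x y t).
Proof.
intro Ht.
set (h := fun n => hermite n x * hermite n y / INR (fact n)).
assert (H0 : subexp h) by apply subexp_hermite_product.
pose proof (subexp_succ _ H0) as H1; pose proof (subexp_succ _ H1) as H2.
pose proof (subexp_succ _ H2) as H3.
(* Shifted by one, [e] is the coefficient sequence of the derivative. *)
set (e := fun n => INR n * h n).
assert (G0 : subexp e).
{ apply subexp_mult; [|exact H0].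
  apply (subexp_le _ (fun n => 0 + 1 * INR n)); [|apply subexp_affine].
  intro n; apply Req_le; f_equal; ring. }
pose proof (subexp_succ _ G0) as G1; pose proof (subexp_succ _ G1) as G2.
pose proof (subexp_succ _ G2) as G3; pose proof (subexp_succ _ G3) as G4.
assert (Hrec : PSeries (fun n => e (S (S (S (S n))))) t
  = x * y * PSeries (fun n => h (S (S (S n)))) t
    + 2 * PSeries (fun n => e (S (S n))) t
    + (1 - x ^ 2 - y ^ 2) * PSeries (fun n => h (S (S n))) t
    + x * y * PSeries (fun n => h (S n)) t - PSeries e t - PSeries h t).
{ pose proof (is_series_lin (- (x * y)) t _ _ _ _ (is_series_subexp _ t H3 Ht)
    (is_series_lin (-2) t _ _ _ _ (is_series_subexp _ t G2 Ht)
    (is_series_lin (- (1 - x ^ 2 - y ^ 2)) t _ _ _ _ (is_series_subexp _ t H2 Ht)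
    (is_series_lin (- (x * y)) t _ _ _ _ (is_series_subexp _ t H1 Ht)
    (is_series_lin 1 t _ _ _ _ (is_series_subexp _ t G4 Ht)
    (is_series_lin 1 t _ _ _ _ (is_series_subexp _ t G0 Ht)
      (is_series_subexp _ t H0 Ht))))))) as HS.
  apply is_series_zero_coef in HS; [lra|].
  intro n; generalize (hermite_product_recurrence x y n); unfold e, h; cbn [Nat.add]; lra. }
pose proof (PSeries_subexp_succ _ t H0 Ht) as E0.
pose proof (PSeries_subexp_succ _ t H1 Ht) as E1.
pose proof (PSeries_subexp_succ _ t H2 Ht) as E2.
pose proof (PSeries_subexp_succ _ t G0 Ht) as F0.
pose proof (PSeries_subexp_succ _ t G1 Ht) as F1.
pose proof (PSeries_subexp_succ _ t G2 Ht) as F2.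
pose proof (PSeries_subexp_succ _ t G3 Ht) as F3.
cbv beta in *; rewrite Hrec in F3; clear Hrec.
pose proof (is_derive_PSeries h t (subexp_CV_radius h t H0 Ht)) as HD.
change (PSeries (PS_derive h) t) with (PSeries (fun n => e (S n)) t) in HD.
change (mehler_gf x y) with (PSeries h).
set (s0 := PSeries h t) in *.
set (s1 := PSeries (fun n => h (S n)) t) in *.
set (s2 := PSeries (fun n => h (S (S n))) t) in *.
set (s3 := PSeries (fun n => h (S (S (S n)))) t) in *.
set (p0 := PSeries e t) in *.
set (p1 := PSeries (fun n => e (S n)) t) in *.
set (p2 := PSeries (fun n => e (S (S n))) t) in *.
set (p3 := PSeries (fun n => e (S (S (S n)))) t) in *.
(* The recurrence covers the differential equation only from [t^3] on; these values settle the lower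
   coefficients. *)
assert (h0 : h 0%nat = 1) by (unfold h; simpl; field).
assert (h1 : h 1%nat = x * y) by (unfold h; simpl; field).
assert (h2 : h 2%nat = (x ^ 2 - 1) * (y ^ 2 - 1) / 2) by (unfold h; simpl; field).
assert (e0 : e 0%nat = 0) by (unfold e; simpl; ring).
assert (e1 : e 1%nat = x * y) by (unfold e; rewrite h1; simpl; ring).
assert (e2 : e 2%nat = (x ^ 2 - 1) * (y ^ 2 - 1)) by (unfold e; rewrite h2; simpl; field).
assert (e3 : e 3%nat = (x ^ 3 - 3 * x) * (y ^ 3 - 3 * y) / 2) by (unfold e, h; simpl; field).
rewrite h0, ?h1, ?h2, ?e0, ?e1, ?e2, ?e3 in *.
replace ((t * (1 - t ^ 2) + x * y * (1 + t ^ 2) - t * (x ^ 2 + y ^ 2))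
     / (1 - t ^ 2) ^ 2 * s0) with p1; [exact HD|].
assert (Ht2 : 0 < 1 - t ^ 2).
{ rewrite <- pow2_abs; generalize (Rabs_pos t); nra. }
assert (T1 : t * s1 = s0 - 1) by lra.
assert (T2 : t ^ 2 * s2 = s0 - 1 - t * (x * y)).
{ replace (t ^ 2 * s2) with (t * (t * s2)) by ring.
  replace (t * s2) with (s1 - x * y) by lra; lra. }
assert (T3 : t ^ 3 * s3 = s0 - 1 - t * (x * y) - t ^ 2 * ((x ^ 2 - 1) * (y ^ 2 - 1) / 2)).
{ replace (t ^ 3 * s3) with (t ^ 2 * (t * s3)) by ring.
  replace (t * s3) with (s2 - (x ^ 2 - 1) * (y ^ 2 - 1) / 2) by lra; lra. }
assert (U2 : t * p2 = p1 - x * y) by lra.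
assert (U3 : t ^ 2 * p3 = p1 - x * y - t * ((x ^ 2 - 1) * (y ^ 2 - 1))).
{ replace (t ^ 2 * p3) with (t * (t * p3)) by ring.
  replace (t * p3) with (p2 - (x ^ 2 - 1) * (y ^ 2 - 1)) by lra; lra. }
(* After this multiplication every sum can be written through [s0] and [p1], leaving one linear
   equation for [p1]. *)
apply (f_equal (Rmult (t ^ 2))) in F3.
rewrite U3, F0 in F3.
assert (K : t ^ 2 * (t * (x * y * s3 + 2 * p2 + (1 - x ^ 2 - y ^ 2) * s2 + x * y * s1 - p0 - s0))
  = x * y * (t ^ 3 * s3) + 2 * t ^ 2 * (t * p2) + (1 - x ^ 2 - y ^ 2) * t * (t ^ 2 * s2)
    + x * y * t ^ 2 * (t * s1) - t ^ 3 * p0 - t ^ 3 * s0) by ring.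
rewrite T1, T2, T3, U2, F0 in K.
apply (Rmult_eq_reg_r ((1 - t ^ 2) ^ 2)); [|apply pow_nonzero; lra].
transitivity ((t * (1 - t ^ 2) + x * y * (1 + t ^ 2) - t * (x ^ 2 + y ^ 2)) * s0);
  [lra | field; lra].
Qed.

(* The generating function and the closed form satisfy the same first-order
   linear equation, so their quotient is constant on (-1, 1). *)
Lemma mehler_gf_closed (x y t : R) :
  Rabs t < 1 ->
  mehler_gf x y t
  = 1 / sqrt (1 - t ^ 2)
    * exp (- ((x - t * y) ^ 2 / (2 * (1 - t ^ 2))) + x ^ 2 / 2).
Proof.
intro Ht.
set (G := fun s => mehler_gf x y s
  * (sqrt (1 - s ^ 2) * exp ((x - s * y) ^ 2 / (2 * (1 - s ^ 2)) - x ^ 2 / 2))).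
assert (Hpos : forall s, Rabs s < 1 -> 0 < 1 - s ^ 2).
{ intros s Hs; rewrite <- pow2_abs; generalize (Rabs_pos s); nra. }
assert (HG : forall s, Rabs s < 1 -> is_derive G s zero).
{ intros s Hs; pose proof (Hpos s Hs) as Hs2.
  pose proof (sqrt_lt_R0 _ Hs2) as Hr.
  pose proof (sqrt_sqrt (1 - s ^ 2) ltac:(lra)) as Hrr.
  unfold G; evar_last.
  - apply is_derive_Reals, derivable_pt_lim_mult; apply is_derive_Reals;
      [apply is_derive_mehler_gf, Hs|].
    auto_derive; [repeat split; try lra; nra | reflexivity].
  - unfold zero; simpl.
    set (E := exp _). set (r := sqrt _) in *.
    (* Clearing the root from the denominator makes [r] a common factor, so the rest is a rational
       identity. *)
    replace (/ (2 * r)) with (r / (2 * (1 - s ^ 2))) by (rewrite <- Hrr; field; lra).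
    field; lra. }
assert (H01 : G t = G 0).
{ destruct (Rtotal_order t 0) as [H|[->|H]]; [|reflexivity|symmetry];
    (apply eq_is_derive; [|exact H]); intros s Hs; apply HG;
    apply Rabs_def1; apply Rabs_def2 in Ht; lra. }
pose proof (sqrt_lt_R0 _ (Hpos t Ht)) as Hr.
assert (G0 : G 0 = 1).
{ unfold G, mehler_gf; rewrite PSeries_0; simpl.
  replace (1 - 0 * (0 * 1)) with 1 by ring; rewrite sqrt_1.
  replace (_ - _) with 0 by field; rewrite exp_0; field. }
rewrite G0 in H01; unfold G in H01.
replace (- ((x - t * y) ^ 2 / (2 * (1 - t ^ 2))) + x ^ 2 / 2)
  with (- ((x - t * y) ^ 2 / (2 * (1 - t ^ 2)) - x ^ 2 / 2)) by ring.
rewrite exp_Ropp.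
set (E := exp _) in *; assert (HE : 0 < E) by apply exp_pos.
apply (Rmult_eq_reg_r (sqrt (1 - t ^ 2) * E)); [|nra].
rewrite H01; field; lra.
Qed.

Lemma mehler (x y t : R) :
  Rabs t < 1 ->
  is_series (fun n => t ^ n / INR (fact n) * hermite n x * hermite n y)
    (1 / sqrt (1 - t ^ 2)
     * exp (- ((x - t * y) ^ 2 / (2 * (1 - t ^ 2))) + x ^ 2 / 2)).
Proof.
intro Ht; rewrite <- mehler_gf_closed by exact Ht.
eapply is_series_ext; [|exact (is_series_subexp _ t (subexp_hermite_product x y) Ht)].
intro n; simpl; field; apply INR_fact_neq_0.
Qed.

(** * The conditional form of Mehler's formula, and assembly of the four identities *)

Lemma Rpower_half_INR (u : R) (n : nat) :
  0 < u -> Rpower u (INR n / 2) = sqrt u ^ n.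
Proof.
intro Hu; rewrite <- (Rpower_pow n) by now apply sqrt_lt_R0.
rewrite <- Rpower_sqrt, Rpower_mult by exact Hu.
f_equal; field.
Qed.

(** Mehler's formula at the standardized arguments with [t = r1 * v / u]. There
    [u^2 - r1^2 * v^2 = 1 - r1^2] yields the new variance, and [y] cancels from the first argument
    minus [t] times the second, leaving [(x - r1 * z) / u]. *)
Lemma mehler_conditional (x y z r1 r2 : R) :
  Rabs r1 < 1 -> Rabs r2 < 1 ->
  is_series
    (fun n => r1 ^ n * Rpower (1 - r2 ^ 2) (INR n / 2)
       / (INR (fact n) * Rpower (1 - r1 ^ 2 * r2 ^ 2) (INR n / 2))
       * hermite n ((x - r1 * r2 * y) / sqrt (1 - r1 ^ 2 * r2 ^ 2))
       * hermite n ((z - r2 * y) / sqrt (1 - r2 ^ 2)))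
    (sqrt ((1 - r1 ^ 2 * r2 ^ 2) / (1 - r1 ^ 2))
     * exp (- ((x - r1 * z) ^ 2 / (2 * (1 - r1 ^ 2)))
            + (x - r1 * r2 * y) ^ 2 / (2 * (1 - r1 ^ 2 * r2 ^ 2)))).
Proof.
intros H1 H2.
assert (Hsq : forall r, Rabs r < 1 -> 0 < 1 - r ^ 2).
{ intros r Hr; rewrite <- pow2_abs; generalize (Rabs_pos r); nra. }
pose proof (Hsq _ H1) as Q1; pose proof (Hsq _ H2) as Q2.
assert (Q12 : 0 < 1 - r1 ^ 2 * r2 ^ 2)
  by (generalize (pow2_ge_0 r1) (pow2_ge_0 r2); nra).
set (u := sqrt (1 - r1 ^ 2 * r2 ^ 2)); set (v := sqrt (1 - r2 ^ 2)).
assert (Hu : 0 < u) by now apply sqrt_lt_R0.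
assert (Hv : 0 < v) by now apply sqrt_lt_R0.
assert (Huu : u ^ 2 = 1 - r1 ^ 2 * r2 ^ 2) by (apply pow2_sqrt; lra).
assert (Hvv : v ^ 2 = 1 - r2 ^ 2) by (apply pow2_sqrt; lra).
set (t := r1 * v / u).
assert (Htt : 1 - t ^ 2 = (1 - r1 ^ 2) / u ^ 2).
{ unfold t; replace (1 - (r1 * v / u) ^ 2) with ((u ^ 2 - r1 ^ 2 * v ^ 2) / u ^ 2)
    by (field; lra).
  rewrite Huu at 1; rewrite Hvv; f_equal; ring. }
assert (Hu2 : 0 < u ^ 2) by (apply pow_lt; lra).
assert (Ht : Rabs t < 1).
{ assert (0 < 1 - t ^ 2) by (rewrite Htt; now apply Rdiv_lt_0_compat).
  rewrite <- (Rabs_pos_eq 1) by lra.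
  apply Rsqr_lt_abs_0; unfold Rsqr; lra. }
pose proof (mehler ((x - r1 * r2 * y) / u) ((z - r2 * y) / v) t Ht) as HS.
eapply is_series_ext;
  [|match type of HS with is_series _ ?l => match goal with |- is_series _ ?m =>
      replace m with l; [exact HS|] end end].
- intro n; match goal with |- @eq _ ?a ?b => change (@eq R a b) end.
  rewrite !Rpower_half_INR by assumption; fold u v.
  generalize (hermite n ((x - r1 * r2 * y) / u)) (hermite n ((z - r2 * y) / v)).
  intros A B; unfold t, Rdiv; rewrite !Rpow_mult_distr, pow_inv.
  field; split; [apply pow_nonzero; lra | apply INR_fact_neq_0].
- rewrite Htt, <- Huu.
  rewrite !sqrt_div by lra; rewrite sqrt_pow2 by lra.
  f_equal.
  + field; split; [|lra]; apply Rgt_not_eq, sqrt_lt_R0; lra.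
  + f_equal; unfold t; field; repeat split; lra.
Qed.

Theorem corollary1 :
  (forall a b x y : R, Rabs a < Rabs b ->
     let rho := a / b in
     is_series
       (fun n : nat =>
          rho ^ n / INR (fact n) * hermite n (x - a) * hermite n (y - b))
       (1 / sqrt (1 - rho ^ 2)
        * exp (- ((x - rho * y) ^ 2 / (2 * (1 - rho ^ 2)))
               + (x - a) ^ 2 / 2)))
  /\
  (forall a b x y : R, Rabs a < Rabs b -> Rabs b < 1 ->
     -2 <= x <= 2 -> -2 <= y <= 2 ->
     let rho := a / b in
     is_series
       (fun n : nat =>
          rho ^ n
          * (chebyU n (x / 2) - a * chebyU_prev n (x / 2))
          * (chebyU n (y / 2) - b * chebyU_prev n (y / 2)))
       ((1 - rho ^ 2) * ((1 - a * x + a ^ 2) / w0 x y rho)))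
  /\
  (forall x y z rho1 rho2 : R, Rabs rho1 < 1 -> Rabs rho2 < 1 ->
     is_series
       (fun n : nat =>
          rho1 ^ n * Rpower (1 - rho2 ^ 2) (INR n / 2)
          / (INR (fact n) * Rpower (1 - rho1 ^ 2 * rho2 ^ 2) (INR n / 2))
          * hermite n ((x - rho1 * rho2 * y) / sqrt (1 - rho1 ^ 2 * rho2 ^ 2))
          * hermite n ((z - rho2 * y) / sqrt (1 - rho2 ^ 2)))
       (sqrt ((1 - rho1 ^ 2 * rho2 ^ 2) / (1 - rho1 ^ 2))
        * exp (- ((x - rho1 * z) ^ 2 / (2 * (1 - rho1 ^ 2)))
               + (x - rho1 * rho2 * y) ^ 2 / (2 * (1 - rho1 ^ 2 * rho2 ^ 2)))))
  /\
  (forall x y z rho1 rho2 : R,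
     -2 <= x <= 2 -> -2 <= y <= 2 -> -2 <= z <= 2 ->
     Rabs rho1 < 1 -> Rabs rho2 < 1 ->
     let term := fun n : nat =>
       rho1 ^ n * ascP n x y (rho1 * rho2) * ascP n z y rho2 in
     ex_series (fun n : nat => term (S n)) /\
     1 + 1 / (1 - rho1 ^ 2 * rho2 ^ 2) * Series (fun n : nat => term (S n))
     = (1 - rho1 ^ 2) * w0 x y (rho1 * rho2)
       / ((1 - rho1 ^ 2 * rho2 ^ 2) * w0 x z rho1)).
Proof.
split; [|split; [|split]].
- intros a b x y Hab rho.
  assert (Hb : b <> 0) by (intros ->; rewrite Rabs_R0 in Hab; generalize (Rabs_pos a); lra).
  (* Since [rho * b = a], the two shifts cancel in this combination. *)
  replace (x - rho * y) with (x - a - rho * (y - b)) by (unfold rho; field; exact Hb).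
  apply mehler, Rabs_div_lt_1, Hab.
- intros a b x y Hab _ Hx Hy rho; now apply chebyshev_bilinear.
- intros x y z r1 r2; apply mehler_conditional.
- intros x y z r1 r2 Hx Hy Hz H1 H2 term.
  pose proof (ascP_bilinear x y z r1 r2 Hx Hy Hz H1 H2) as HS.
  split; [eexists; exact HS|].
  change (fun n => term (S n)) with
    (fun n => r1 ^ S n * ascP (S n) x y (r1 * r2) * ascP (S n) z y r2).
  rewrite (is_series_unique _ _ HS).
  pose proof (w0_pos x z r1 Hx Hz H1).
  assert (r1 ^ 2 < 1 /\ r2 ^ 2 < 1) as [Q1 Q2].
  { rewrite <- (pow2_abs r1), <- (pow2_abs r2).
    generalize (Rabs_pos r1) (Rabs_pos r2); nra. }
  assert (0 < 1 - r1 ^ 2 * r2 ^ 2)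
    by (generalize (pow2_ge_0 r1) (pow2_ge_0 r2); nra).
  field; lra.
Qed.
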